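(* For every $n\ge1$ and every vector ${\bf m}=(m_1,\ldots,m_n)$ of positive integers, the polynomial $\sum_{\pi\in P^{\pm}({\bf m})}t^{\operatorname{des}(\pi)}$ has only real roots.
   Context: $P^{\pm}({\bf m})$ is the set of signed permutations of the multiset $\{1^{m_1},2^{m_2},\ldots,n^{m_n}\}$: words $\pi_1\cdots\pi_m$ ($m=m_1+\cdots+m_n$) of nonzero integers such that $|\pi_1|\cdots|\pi_m|$ is an arrangement of the multiset, each entry carrying an arbitrary sign. A descent of $\pi$ is an index $i\in\{0,\ldots,m-1\}$ with $\pi_i>\pi_{i+1}$, where $\pi_0=0$; $\operatorname{des}(\pi)$ is the number of descents. *)

(* Defs.v *)
From HB Require Import structures.
From mathcomp Require Import all_boot all_order all_algebra.

Set Implicit Arguments.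
Unset Strict Implicit.
Unset Printing Implicit Defensive.

Import Order.TTheory GRing.Theory Num.Theory.
Local Open Scope ring_scope.

(* Letters of signed words are pairs (sign, i) with i : 'I_n; the value i of an
   ordinal stands for the letter i + 1, and the sign true for a minus. *)
Definition letter (n : nat) (x : bool * 'I_n) : int :=
  (-1) ^+ x.1 * (x.2.+1)%:Z.

Definition entries (n k : nat) (w : k.-tuple (bool * 'I_n)) : seq int :=
  [seq letter x | x <- w].

Definition multiset (n : nat) (m : 'I_n -> nat) : seq nat :=
  flatten [seq nseq (m i) i.+1 | i <- enum 'I_n].

Definition signed_perms (n : nat) (m : 'I_n -> nat) :
    {set (\sum_i m i).-tuple (bool * 'I_n)} :=
  [set w | perm_eq [seq `|x|%N | x <- entries w] (multiset m)].

(* The i-th term of 0 :: s is s_i in the 1-based indexing with s_0 = 0. *)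
Definition des (s : seq int) : nat :=
  #|[set i : 'I_(size s) | nth 0 (0 :: s) i > nth 0 (0 :: s) i.+1]|.

Definition descent_poly (n : nat) (m : 'I_n -> nat) : {poly int} :=
  \sum_(w in signed_perms m) 'X^(des (entries w)).

Lemma absz_letter n (x : bool * 'I_n) : `|letter x|%N = x.2.+1.
Proof. by rewrite /letter abszMsign. Qed.

Lemma letter_inj n : injective (@letter n).
Proof.
move=> [b i] [c j] e; have := congr1 absz e; rewrite !absz_letter /= => -[eij].
have {eij} eij : i = j by apply: val_inj.
by move: e; rewrite eij /letter; case: b; case: c.
Qed.

Lemma entries_inj n k : injective (@entries n k).
Proof. by move=> w v e; apply/val_inj/(inj_map (@letter_inj n)). Qed.

Lemma size_multiset n (m : 'I_n -> nat) : size (multiset m) = (\sum_i m i)%N.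
Proof.
rewrite size_flatten /shape -map_comp sumnE big_map big_enum /=.
by apply: eq_bigr => i _; rewrite size_nseq.
Qed.

(* Together with entries_inj: w |-> entries w is a bijection from signed_perms m
   onto the set of words of integers whose absolute values arrange multiset m. *)
Lemma entries_signed_permsP n (m : 'I_n -> nat) (s : seq int) :
  reflect (exists2 w, w \in signed_perms m & s = entries w)
          (perm_eq [seq `|x|%N | x <- s] (multiset m)).
Proof.
apply: (iffP idP) => [ps|[w]]; last by rewrite inE => ? ->.
have sz : size s = (\sum_i m i)%N.
  by rewrite -(size_multiset m) -(perm_size ps) size_map.
have lts x : x \in s -> exists i : bool * 'I_n, x = letter i.
  move=> xs; have : `|x|%N \in multiset m.
    by rewrite -(perm_mem ps) map_f.
  case/flatten_mapP => i _; rewrite mem_nseq => /andP[_ /eqP xi].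
  by exists (x < 0, i); rewrite /letter /= -xi -intEsign.
have [t st] : exists t : seq (bool * 'I_n), s = map (@letter n) t.
  elim: s lts {ps sz} => [|x s IH] lts; first by exists [::].
  have [i ->] := lts x (mem_head _ _).
  have [t ->] := IH (fun y ys => lts y (mem_behead (s := x :: s) ys)).
  by exists (i :: t).
have szt : size t == (\sum_i m i)%N by rewrite -sz st size_map.
by exists (Tuple szt); rewrite ?inE /entries /= -?st.
Qed.

(* Main.v *)
Require Import Defs.
From HB Require Import structures.
From mathcomp Require Import all_boot all_order all_algebra.
From mathcomp Require Import complex reals.
From mathcomp Require Import ring zify.

(* With k bars allowed in a word, the words whose descents all carry a bar are
   counted by prod_i C(2k + m_i, m_i), so the descent polynomial is the numerator
   over (1 - t)^(m+1) of the generating function of these numbers.  Each of them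
   is a product of factors (k + c) with 2c a positive integer, and multiplying
   the coefficients by k + c acts on numerators P over (1 - t)^(d+1) by
     P |-> t (1 - t) P' + ((d + 1 - c) t + c) P.
   As long as deg P + c <= d + 1, this operator preserves the property that all
   roots are real and smaller than 1: at a new root z the logarithmic derivative
   shows that the conjugate of z is dominated by a convex combination of 0 and
   of the old roots, as in the Gauss-Lucas theorem. *)

Set Implicit Arguments.
Unset Strict Implicit.
Unset Printing Implicit Defensive.

Import Order.TTheory GRing.Theory Num.Theory.
Local Open Scope ring_scope.

(** * Location of the roots under the operator on numerators *)

Section RootsBelowOne.

Variable C : numClosedFieldType.
Implicit Types (P : {poly C}) (s : seq C) (c z : C) (d k : nat).

Lemma horner_deriv_prod_XsubC s z : z \notin s ->
  (\prod_(a <- s) ('X - a%:P))^`().[z]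
  = (\prod_(a <- s) ('X - a%:P)).[z] * \sum_(a <- s) (z - a)^-1.
Proof.
elim: s => [|a s IHs] zs; first by rewrite !big_nil derivC hornerC mulr0.
move: zs; rewrite inE negb_or => /andP[za zs].
rewrite !big_cons derivM derivXsubC mul1r hornerD !hornerM IHs // hornerXsubC.
rewrite mulrDr mulrA; congr (_ + _).
by rewrite mulrAC divff ?mul1r // subr_eq0.
Qed.

(* The equation exhibits the conjugate of z as a convex combination of 0, of
   the elements of s and of -oo. *)
Lemma lt1_of_resolvent_eq0 s c N z :
    all (fun a => a < 1) s -> z \notin s -> z != 0 -> 0 < c -> 0 <= N ->
  N + \sum_(a <- s) (1 - a) / (z - a) + c / z = 0 -> z < 1.
Proof.
move=> /allP s1 zs z0 c0 N0 e.
(* Since 1/x = conj x / |x|^2, the hypothesis becomes (1 - conj z) (sum w + v) = N + sum w a (1 - a)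
   + v, where the right side and the factor sum w + v are positive. *)
pose w a := (1 - a) / `|z - a| ^+ 2; pose v := c / `|z| ^+ 2.
have inv_conj x : x^-1 = x^* / `|x| ^+ 2.
  have [->|x0] := eqVneq x 0; first by rewrite conjC0 invr0 mul0r.
  by rewrite normCK invfM mulrA [_ / x]mulrC -mulrA divff ?mulr1 // conjC_eq0.
have w_ge0 a : a \in s -> 0 <= w a.
  by move=> /s1 a1; rewrite divr_ge0 ?exprn_ge0 ?subr_ge0 ?normr_ge0 // ltW.
have v_gt0 : 0 < v by rewrite divr_gt0 // exprn_gt0 // normr_gt0.
have sumE : \sum_(a <- s) (1 - a) / (z - a)
    = \sum_(a <- s) w a * (1 - a) - (1 - z^*) * \sum_(a <- s) w a.
  rewrite mulr_sumr -sumrB; apply: eq_big_seq => a /s1 a1.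
  have ar : a^* = a.
    by apply: Num.Theory.CrealP; rewrite -(subrK 1 a) rpredD ?rpred1 // ltr0_real ?subr_lt0.
  by rewrite inv_conj rmorphB /= ar /w; ring.
have vE : c / z = v - (1 - z^*) * v by rewrite inv_conj /v; ring.
have W0 : 0 < \sum_(a <- s) w a + v.
  by rewrite ltr_wpDl // big_seq sumr_ge0.
have uE : (1 - z^*) * (\sum_(a <- s) w a + v)
    = N + \sum_(a <- s) w a * (1 - a) + v.
  apply/eqP; rewrite -subr_eq0 -oppr_eq0 -[X in _ == X]e sumE vE.
  by apply/eqP; ring.
have : 0 < 1 - z^*.
  rewrite -(pmulr_lgt0 _ W0) uE ltr_wpDl // addr_ge0 // big_seq sumr_ge0 //.
  by move=> a as_; rewrite mulr_ge0 ?w_ge0 // subr_ge0 ltW // s1.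
(* The order on [C] is partial: being below 1 makes conj z real, hence equal to z. *)
rewrite subr_gt0 => zc1; have zcr : z^* \is Num.real.
  by rewrite -(subrK 1 z^*) rpredD ?rpred1 // ltr0_real ?subr_lt0.
by rewrite -(conjCK z) (Num.Theory.CrealP zcr).
Qed.

(* If P / (1 - t)^(d+1) is the generating function of f(k), then
   shift_op c d P / (1 - t)^(d+2) is the one of (k + c) f(k). *)
Definition shift_op c d P : {poly C} :=
  'X * (1 - 'X) * P^`() + ((d.+1%:R - c) *: 'X + c%:P) * P.

Lemma coef_shift_op0 c d P : (shift_op c d P)`_0 = c * P`_0.
Proof.
by rewrite /shift_op coefD -mulrA coefXM eqxx add0r mulrDl -scalerAl coefD
  coefZ coefXM coefCM eqxx mulr0 add0r.
Qed.

Lemma coef_shift_opS c d P e :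
  (shift_op c d P)`_e.+1
  = (e.+1%:R + c) * P`_e.+1 + (d.+1%:R - c - e%:R) * P`_e.
Proof.
rewrite /shift_op coefD -mulrA coefXM /= !mulrBl mul1r coefB coefXM !coef_deriv.
rewrite mulrDl -scalerAl coefD coefZ coefXM coefCM /=.
case: e => [|e] /=; rewrite -![P`_ _ *+ _]mulr_natl; ring.
Qed.

(** At a root z of the new polynomial that is neither 0 nor a root of P, dividing by z P(z) gives
    the equation of [lt1_of_resolvent_eq0] with N = d + 1 - c - deg P, nonnegative by the size
    bound. *)
Lemma root_shift_op_lt1 c d P : 0 < c -> (size P)%:R + c <= d.+2%:R ->
    (forall z, root P z -> z < 1) ->
  forall z, root (shift_op c d P) z -> z < 1.
Proof.
move=> c0 szP P1 z rz.
have [/P1//|nPz] := boolP (root P z).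
have P0 : P != 0 by apply: contraNneq nPz => ->; rewrite root0.
have [s Ps] := closed_field_poly_normal P.
have lP : lead_coef P != 0 by rewrite lead_coef_eq0.
have s1 : all (fun a => a < 1) s.
  apply/allP => a as_; apply: P1; rewrite Ps rootZ // root_prod_XsubC //.
have szs : size P = (size s).+1 by rewrite Ps size_scale // size_prod_XsubC.
have zs : z \notin s by move: nPz; rewrite Ps rootZ // root_prod_XsubC.
have [->//|z0] := eqVneq z 0.
have [z1|z1] := eqVneq z 1.
  move: rz; rewrite /shift_op z1 /root !hornerE subrr mul0r add0r.
  by rewrite subrK mulf_eq0 pnatr_eq0 /= -z1; move: nPz; rewrite /root => /negPf ->.
have N0 : 0 <= d.+1%:R - c - (size s)%:R :> C.
  move: szP; rewrite szs -(natr1 d.+1) -natr1 -subr_ge0.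
  by congr (0 <= _); ring.
apply: (lt1_of_resolvent_eq0 s1 zs z0 c0 N0).
have zs_sub a : a \in s -> z - a != 0.
  by move=> as_; rewrite subr_eq0; apply: contraNneq zs => ->.
have sumE : \sum_(a <- s) (1 - a) / (z - a)
   = (size s)%:R - (z - 1) * \sum_(a <- s) (z - a)^-1.
  rewrite mulr_sumr -sum1_size natr_sum -sumrB; apply: eq_big_seq => a as_.
  by have := zs_sub a as_ => za; field.
move: rz nPz; rewrite /shift_op /root !hornerE.
have -> : P^`().[z] = P.[z] * \sum_(a <- s) (z - a)^-1.
  by rewrite {1 2}Ps derivZ !hornerZ horner_deriv_prod_XsubC // mulrA.
rewrite sumE => eq0 nPz; set S := \sum_(a <- s) _ in eq0 *.
have : P.[z] * (z * (1 - z) * S + ((d.+1%:R - c) * z + c)) == 0.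
  by rewrite -(eqP eq0); apply/eqP; ring.
rewrite mulf_eq0 (negPf nPz) /= => /eqP e.
apply/eqP; rewrite -(inj_eq (mulfI z0)) mulr0 -e.
by apply/eqP; field.
Qed.

Lemma size_shift_op c d P : (size (shift_op c d P) <= (size P).+1)%N.
Proof.
apply/leq_sizeP => -[|e] // le; rewrite coef_shift_opS.
by rewrite !nth_default ?mulr0 ?addr0 // ltnW.
Qed.

(** The coefficient in degree deg P + 1 is d + 1 - c - deg P times the leading one of P, and here
    this factor is 0. *)
Lemma size_shift_op_cancel c d P : (size P)%:R + c = d.+2%:R ->
  (size (shift_op c d P) <= size P)%N.
Proof.
move=> szP; apply/leq_sizeP => -[|e].
  by rewrite leqn0 size_poly_eq0 => /eqP ->; rewrite coef_shift_op0 coef0 mulr0.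
rewrite leq_eqVlt coef_shift_opS => /orP[/eqP szPe|le]; last first.
  by rewrite !nth_default ?mulr0 ?addr0 // ltnW.
rewrite nth_default ?szPe // mulr0 add0r.
have -> : d.+1%:R - c - e%:R = 0; last by rewrite mul0r.
move: szP; rewrite szPe -!natr1 => /eqP; rewrite -subr_eq0 => /eqP e0.
apply/eqP; rewrite -oppr_eq0 -e0; apply/eqP; ring.
Qed.

(** * Numerators and coefficients of the generating functions *)

(** The coefficient of t^k in P / (1 - t)^(d+1). *)
Definition gf_coef d P k : C :=
  \sum_(e < k.+1) P`_e * 'C(k - e + d, d)%:R.

Lemma gf_coefZ a d P k : gf_coef d (a *: P) k = a * gf_coef d P k.
Proof.
by rewrite /gf_coef mulr_sumr; apply: eq_bigr => e _; rewrite coefZ mulrA.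
Qed.

(** The linear system for the coefficients of P is triangular with 1 on the diagonal. *)
Lemma gf_coef_inj d P Q : gf_coef d P =1 gf_coef d Q -> P = Q.
Proof.
move=> PQ; apply/polyP => k; elim/ltn_ind: k => k IHk.
move: (PQ k); rewrite /gf_coef !big_ord_recr /= subnn add0n binn !mulr1.
under eq_bigr => e _ do rewrite IHk //.
exact: addrI.
Qed.

Lemma gf_coef_shift_op c d P k :
  gf_coef d.+1 (shift_op c d P) k = (k%:R + c) * gf_coef d P k.
Proof.
have bin_up x : d.+1%:R * 'C(x + d.+1, d.+1)%:R
    = (x + d.+1)%:R * 'C(x + d, d)%:R :> C.
  by rewrite -!natrM addnS -mul_bin_diag.
have bin_same x : d.+1%:R * 'C(x + d, d.+1)%:R = x%:R * 'C(x + d, d)%:R :> C.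
  by rewrite -!natrM mul_bin_left addnK.
rewrite /gf_coef mulr_sumr big_ord_recl /= coef_shift_op0 subn0.
under eq_bigr => e _ do rewrite /bump /= add1n coef_shift_opS mulrDl.
rewrite big_split /= addrA.
pose F e := (e%:R + c) * P`_e * 'C(k - e + d.+1, d.+1)%:R.
rewrite (_ : c * _ * _ + _ = \sum_(e < k.+1) F e); last first.
  by rewrite big_ord_recl /F /= subn0 add0r.
pose G e := (d.+1%:R - c - e%:R) * P`_e * 'C(k - e + d, d.+1)%:R.
rewrite (_ : \sum_(i < k) _ = \sum_(e < k.+1) G e); last first.
  rewrite big_ord_recr /= {2}/G subnn add0n bin_small // mulr0 addr0.
  by apply: eq_bigr => e _; rewrite /G -addSnnS -subSn // subSS.
rewrite -big_split /=; apply: eq_bigr => -[e lek] _ /=; rewrite /F /G.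
apply: (mulfI (_ : d.+1%:R != 0 :> C)); first by rewrite pnatr_eq0.
move: (bin_up (k - e)%N) (bin_same (k - e)%N).
have -> : k%:R = (k - e)%:R + e%:R :> C by rewrite -natrD subnK.
move: (k - e)%N => x; rewrite natrD => bu bs.
rewrite mulrDr ![d.+1%:R * (_ * _ * _)]mulrCA bu bs; ring.
Qed.

(** Starting from 1 / (1 - t), each step from C(2k+j, j) to C(2k+j+1, j+1) multiplies by (k + c) / c
    with c = (j+1)/2, which is [shift_op] up to a scalar. *)
Lemma ex_gf_poly (s : seq nat) :
  exists P : {poly C},
    [/\ forall z, root P z -> z < 1, (size P <= (sumn s).+1)%N
      & forall k, gf_coef (sumn s) P k
          = \prod_(j <- s) 'C(k.*2 + j, j)%:R].
Proof.
elim: s => [|j s [P [P1 szP gfP]]] /=.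
  exists 1; split=> [z||k]; first by rewrite (negPf (root1 z)).
    by rewrite size_poly1.
  rewrite big_nil /gf_coef big_ord_recl /= coef1 bin0 mulr1 big1 ?addr0 // => e _.
  by rewrite coef1 mul0r.
(* The integral zeros -1, ..., -j./2 of C(2k + j, j) lower the degree of the
   numerator, which keeps the degree condition of root_shift_op_lt1. *)
suff [Q [Q1 szQ gfQ]] : exists Q : {poly C},
    [/\ forall z, root Q z -> z < 1,
        (size Q + j./2 <= (j + sumn s).+1)%N
      & forall k, gf_coef (j + sumn s) Q k
          = 'C(k.*2 + j, j)%:R * gf_coef (sumn s) P k].
  exists Q; split => [//||k]; first exact: leq_trans (leq_addr _ _) szQ.
  by rewrite gfQ big_cons gfP.
elim: j => [|j [Q [Q1 szQ gfQ]]].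
  by exists P; split=> [//||k]; rewrite ?addn0 // bin0 mul1r.
pose c : C := j.+1%:R / 2; pose d := (j + sumn s)%N.
have c0 : 0 < c by rewrite divr_gt0 ?ltr0n.
have c2 : c * 2 = j.+1%:R by rewrite divfK // pnatr_eq0.
have nzc : c^-1 != 0 by rewrite invr_eq0 gt_eqF.
have szc : (size Q)%:R + c <= d.+2%:R.
  rewrite -(ler_pM2r (ltr0n C 2)) mulrDl c2 -!natrM -natrD ler_nat.
  by rewrite /d; lia.
exists (c^-1 *: shift_op c d Q); split=> [z||k].
- by rewrite rootZ // => /root_shift_op_lt1; apply.
- rewrite size_scale //.
  have := size_shift_op c d Q; rewrite -[j.+1./2]/(uphalf j) uphalf_half.
  have := odd_double_half j; move: szQ; rewrite addSn -/d.
  case: (odd j) => /= szQ jE; last first.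
    by move: szQ; move: (size Q) (size (shift_op c d Q)) => q r; lia.
  (* For odd j, c is an integer and the budget for the size does not grow; if it is already
     exhausted, then size Q + c = d + 2 and the leading terms cancel. *)
  have [lt|ge] := ltnP (size Q + j./2) d.+1; first move: lt.
    by move: (size Q) (size (shift_op c d Q)) => q r; lia.
  suff : (size (shift_op c d Q) <= size Q)%N.
    by move: szQ; move: (size Q) (size (shift_op c d Q)) => q r; lia.
  apply: size_shift_op_cancel.
  apply: (mulIf (_ : 2 != 0 :> C)); first by rewrite pnatr_eq0.
  rewrite mulrDl c2 -!natrM -natrD; congr (_%:R).
  by move: szQ ge; move: (size Q) => q; lia.
- rewrite gf_coefZ addSn gf_coef_shift_op gfQ mulrA [RHS]mulrC [in RHS]mulrC mulrA.
  congr (_ * _).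
  have : j.+1%:R * 'C(k.*2 + j.+1, j.+1)%:R
    = (k.*2 + j.+1)%:R * 'C(k.*2 + j, j)%:R :> C.
    by rewrite -!natrM addnS -mul_bin_diag.
  rewrite natrD -c2 -muln2 natrM -mulrDl => e.
  apply: (mulfI (_ : c * 2 != 0)); first by rewrite c2 pnatr_eq0.
  by rewrite e; field; rewrite gt_eqF.
Qed.

End RootsBelowOne.

(** * Descents by recursion on the word *)

Fixpoint des_from (a : int) (s : seq int) : nat :=
  if s is x :: s' then ((x < a)%R + des_from x s')%N else 0%N.

Lemma des_from_size a s : (des_from a s <= size s)%N.
Proof.
elim: s a => //= x s IHs a; rewrite -add1n leq_add ?IHs //.
exact: leq_b1.
Qed.

Lemma desE s : des s = des_from 0 s.
Proof.
suff E a : (\sum_(i < size s) (nth 0%R (a :: s) i.+1 < nth 0%R (a :: s) i)%R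
    = des_from a s)%N.
  rewrite -E /des cardsE -sum1_card big_mkcond /=.
  apply: eq_bigr => i _; by rewrite unfold_in.
elim: s a => [|x s IHs] a /=; first by rewrite big_ord0.
by rewrite big_ord_recl /= -IHs.
Qed.

Lemma sum_tuple_cons (T : finType) N (F : seq T -> nat) :
  (\sum_(w : N.+1.-tuple T) F w = \sum_(x : T) \sum_(w : N.-tuple T) F (x :: w))%N.
Proof.
rewrite pair_bigA /=.
rewrite (reindex (fun p : T * N.-tuple T => [tuple of p.1 :: p.2])) //=.
exists (fun w => (thead w, [tuple of behead w])) => [[x w]|w] _ /=.
  by rewrite theadE; congr (_, _); apply: val_inj.
by rewrite -tuple_eta.
Qed.

(** * A Worpitzky identity for signed multiset permutations *)

Section Worpitzky.

Variable n : nat.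
Notation L := (bool * 'I_n)%type.
Implicit Types (m : 'I_n -> nat) (w : seq L) (x : L) (a : int) (i : 'I_n).

Definition has_content m w := [forall i, count (fun x => x.2 == i) w == m i].

Definition decr m i0 i := (m i - (i0 == i))%N.

Lemma has_content_cons m x w :
  has_content m (x :: w) = (0 < m x.2)%N && has_content (decr m x.2) w.
Proof.
apply/forallP/andP => [h|[m0 /forallP h] i].
  split; first by have := h x.2; rewrite /= eqxx => /eqP <-.
  apply/forallP => i; have := h i; rewrite /= /decr; lia.
have := h i; rewrite /= /decr => /eqP ->; case: (eqVneq x.2 i) m0 => [->|_] m0; lia.
Qed.

Lemma sum_decr m i : (0 < m i)%N ->
  (\sum_j m j = (\sum_j decr m i j).+1)%N.
Proof.
move=> mi; rewrite (bigD1 i) // [in RHS](bigD1 i) //= /decr eqxx.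
rewrite -addSn -subSn // subSS subn0; congr (_ + _)%N.
by apply: eq_bigr => j; rewrite eq_sym => /negPf ->; rewrite subn0.
Qed.

Lemma letter_bounds x : - n%:Z <= letter x <= n%:Z.
Proof. by case: x => [[] i]; have := ltn_ord i; rewrite /letter /=; lia. Qed.

(** Counts the words preceded by a with K bars placed in the M + 1 gaps, each descent carrying at
    least one: K - des bars remain free, whence C(K + M - des, M). *)
Definition worp a K M m : nat :=
  (\sum_(w : M.-tuple L)
     has_content m w * 'C(K + M - des_from a (map (@letter n) w), M))%N.

Lemma worpS a K M m :
  worp a K M.+1 m = (\sum_x \sum_(w : M.-tuple L) has_content m (x :: w) *
     'C(K + M.+1 - ((letter x < a)%R + des_from (letter x) (map (@letter n) w)),
        M.+1))%N.
Proof.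
exact: (sum_tuple_cons M (fun w =>
  has_content m w * 'C(K + M.+1 - des_from a (map (@letter n) w), M.+1))%N).
Qed.

(** Raising the bound past [letter x] creates a descent exactly in the words that start with x; by
    Pascal's rule the difference counts these words with x removed. *)
Lemma worp_letter x K M m :
  worp (letter x) K M.+1 m
  = (worp (letter x + 1) K M.+1 m
     + (0 < m x.2)%N * worp (letter x) K M (decr m x.2))%N.
Proof.
rewrite !worpS (bigD1 x) //= [in RHS](bigD1 x) //= -addnA [in RHS]addnCA addnC.
congr (_ + _)%N.
  apply: eq_bigr => y yx; apply: eq_bigr => w _.
  rewrite ltzD1 [in RHS]le_eqVlt (inj_eq (@letter_inj n)) (negPf yx) //.
rewrite /worp big_distrr -big_split /=; apply: eq_bigr => w _.
rewrite has_content_cons -mulnb mulnA -mulnDr; congr (_ * _)%N.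
rewrite ltxx ltzD1 lexx add0n.
have := des_from_size (letter x) (map (@letter n) w).
rewrite size_map size_tuple => dM.
by rewrite addnS subSn ?binS ?subSS // (leq_trans dM) // leq_addl.
Qed.

Lemma worp_zero K M m : worp 0 K M m = worp 1 K M m.
Proof.
case: M => [|M]; first by apply: eq_bigr => w _; rewrite tuple0.
rewrite !worpS; apply: eq_bigr => x _; apply: eq_bigr => w _.
suff -> : (letter x < 0) = (letter x < 1) by [].
by case: x => [[] i]; rewrite /letter /=; lia.
Qed.

(** Below n + 1 every first letter makes a descent, which uses up one bar; after -n none does. *)
Lemma worp_wrap K M m : worp n.+1%:Z K.+1 M.+1 m = worp (- n%:Z) K M.+1 m.
Proof.
rewrite !worpS; apply: eq_bigr => x _; apply: eq_bigr => w _.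
have /andP[l u] := letter_bounds x.
have -> : letter x < n.+1%:Z by lia.
have -> : (letter x < - n%:Z) = false by lia.
by rewrite /= add1n addSn subSS.
Qed.

Lemma worp_top M m : worp n.+1%:Z 0 M.+1 m = 0%N.
Proof.
rewrite !worpS big1 // => x _; rewrite big1 // => w _.
have /andP[l u] := letter_bounds x.
have -> : letter x < n.+1%:Z by lia.
by rewrite bin_small ?muln0 //=; lia.
Qed.

Lemma worp0 a K m : (\sum_i m i = 0)%N -> worp a K 0 m = 1%N.
Proof.
move=> m0; rewrite /worp (big_pred1 [tuple]) => [|w]; last first.
  by rewrite [w]tuple0 /= eqxx.
rewrite bin0 muln1 /has_content; case: forallP => // -[] i /=.
by move/eqP: m0; rewrite sum_nat_eq0 => /forallP/(_ i)/=; rewrite eq_sym.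
Qed.

(* The number of letters ±(i+1) available in the levels 0..K, only those at
   least a being allowed in level 0. *)
Definition slots a K i : nat :=
  (K.*2 + (a <= i.+1%:Z)%R + (a <= - i.+1%:Z)%R)%N.

(** The recurrence of [worp_letter]: lowering the bound to [letter x] adds one slot, for the index
    [x.2] only, and Pascal's rule applies to that factor. *)
Lemma prod_slots_letter x K m :
  (\prod_i 'C(slots (letter x) K i + m i - 1, m i)
   = \prod_i 'C(slots (letter x + 1) K i + m i - 1, m i)
     + (0 < m x.2)%N
       * \prod_i 'C(slots (letter x) K i + decr m x.2 i - 1, decr m x.2 i))%N.
Proof.
have slots_neq i : i != x.2 -> slots (letter x + 1) K i = slots (letter x) K i.
  rewrite -val_eqE /slots /letter; case: x => [[] j] /=; lia.
have slots_eq : slots (letter x) K x.2 = (slots (letter x + 1) K x.2).+1.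
  by rewrite /slots /letter; case: x {slots_neq} => [[] j] /=; lia.
rewrite (bigD1 x.2) // [X in (_ = X + _)%N](bigD1 x.2) //=.
rewrite [X in (_ = _ + _ * X)%N](bigD1 x.2) //=.
have -> : (\prod_(i | i != x.2) 'C(slots (letter x + 1) K i + m i - 1, m i)
    = \prod_(i | i != x.2) 'C(slots (letter x) K i + m i - 1, m i))%N.
  by apply: eq_bigr => i ix; rewrite slots_neq.
have -> : (\prod_(i | i != x.2)
      'C(slots (letter x) K i + decr m x.2 i - 1, decr m x.2 i)
    = \prod_(i | i != x.2) 'C(slots (letter x) K i + m i - 1, m i))%N.
  by apply: eq_bigr => i; rewrite /decr eq_sym => /negPf ->; rewrite subn0.
rewrite mulnA -mulnDl; congr (_ * _)%N.
rewrite /decr eqxx slots_eq; case: (m x.2) => [|k]; first by rewrite !bin0.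
move: (slots _ K _) => p.
rewrite (_ : p.+1 + k.+1 - 1 = (p + k).+1)%N ?binS; last by lia.
rewrite mul1n (_ : p + k.+1 - 1 = p + k)%N; last by lia.
by rewrite (_ : k.+1 - 1 = k)%N ?addSn ?subSS ?subn0 //; lia.
Qed.

Lemma letter_surj a : - n%:Z <= a <= n%:Z -> a != 0 -> exists x, a = letter x.
Proof.
move=> a_n a0; have lt : (`|a|.-1 < n)%N by lia.
by exists (a < 0, Ordinal lt); rewrite /letter /= prednK ?absz_gt0 // -intEsign.
Qed.

(** Nested induction on K, on t = n + 1 - a and on M. At a = n + 1 level 0 is empty, and the
    induction continues with K - 1 levels of bars from a = -n, where t = 2n + 1. *)
Lemma worpE a K M m : - n%:Z <= a <= n.+1%:Z -> (\sum_i m i = M)%N ->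
  worp a K M m = (\prod_i 'C(slots a K i + m i - 1, m i))%N.
Proof.
move=> /andP[al au].
have [t ta] : exists t : nat, a = n.+1%:Z - t%:Z.
  by exists `|n.+1%:Z - a|%N; lia.
elim/ltn_ind: K t a ta al au M m => K IHK.
elim=> [|t IHt] a ta al au; elim=> [|M IHM] m sm.
1,3: rewrite worp0 // big1 // => i _; move/eqP: sm;
  by rewrite sum_nat_eq0 => /forallP/(_ i)/eqP ->; rewrite bin0.
- case: K IHK {IHM} => [|K] IHK; rewrite ta subr0.
    (* With no slots at all, an index with m i > 0 contributes C(m i - 1, m i) = 0. *)
    have /existsP[i mi] : [exists i, m i != 0%N].
      apply: contraPT sm => /existsPn m0; rewrite big1 // => i _.
      by apply/eqP; rewrite -[_ == _]negbK.
    rewrite worp_top (bigD1 i) //= /slots bin_small //.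
    by have := ltn_ord i; lia.
  rewrite worp_wrap (IHK K _ n.*2.+1) ?sm //; try lia.
  apply: eq_bigr => i _; congr ('C(_, _)); rewrite /slots.
  by have := ltn_ord i; lia.
- have [a0|a0] := eqVneq a 0.
    by rewrite a0 worp_zero (IHt 1) ?sm //; lia.
  have [|x ax] := letter_surj _ a0; first by lia.
  rewrite ax worp_letter prod_slots_letter IHt ?sm //; try lia.
  have [m0|m0] := posnP (m x.2); first by rewrite !mul0n.
  by rewrite -ax IHM //; move: sm; rewrite (sum_decr m0) => -[].
Qed.

Lemma signed_perms_content m (w : (\sum_i m i).-tuple L) :
  (w \in signed_perms m) = has_content m w.
Proof.
rewrite inE /entries -map_comp.
have cm i : count_mem i.+1 (multiset m) = m i.
  rewrite /multiset count_flatten -map_comp sumnE big_map big_enum /=.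
  rewrite (bigD1 i) //= count_nseq /= eqxx mul1n big1 ?addn0 // => j ji.
  by rewrite count_nseq /= eqSS val_eqE (negPf ji).
have cw i : count_mem i.+1 (map (absz \o @letter n) w)
    = count (fun x => x.2 == i) w.
  by rewrite count_map; apply: eq_count => x /=; rewrite absz_letter eqSS.
apply/idP/forallP => [/permP pw i|h].
  by rewrite -cw pw cm.
apply/allP => y; rewrite mem_cat => hy; apply/eqP.
suff [i ->] : exists i : 'I_n, y = i.+1 by rewrite cw cm (eqP (h i)).
case/orP: hy => [/mapP[x _ ->]|]; first by exists x.2; rewrite /= absz_letter.
by case/flatten_mapP => i _ /nseqP[-> _]; exists i.
Qed.

(** The case a = 0: level 0 admits only positive letters, so each index has 2K + 1 slots. *)
Lemma worpitzky m K :
  (\sum_(w in signed_perms m)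
     'C(K + \sum_i m i - des (entries w), \sum_i m i)
   = \prod_i 'C(K.*2 + m i, m i))%N.
Proof.
have -> : (\prod_i 'C(K.*2 + m i, m i)
    = \prod_i 'C(slots 0 K i + m i - 1, m i))%N.
  by apply: eq_bigr => i _; congr ('C(_, _)); rewrite /slots; lia.
rewrite -(@worpE _ _ (\sum_i m i)) //; last by lia.
rewrite /worp big_mkcond /=; apply: eq_bigr => w _.
by rewrite signed_perms_content desE; case: has_content; rewrite ?mul1n ?mul0n.
Qed.

End Worpitzky.

(** * Identification of the descent polynomial and conclusion *)

Lemma gf_coef_descent_poly (C : numClosedFieldType) n (m : 'I_n -> nat) k :
  gf_coef (\sum_i m i) (map_poly intr (descent_poly m) : {poly C}) k
  = \prod_i 'C(k.*2 + m i, m i)%:R.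
Proof.
rewrite -natr_prod -worpitzky natr_sum /gf_coef.
rewrite (eq_bigr (fun e : 'I_k.+1 => \sum_(w in signed_perms m)
   (des (entries w) == e)%:R * 'C(k - e + \sum_i m i, \sum_i m i)%:R)); last first.
  move=> e _; rewrite coef_map /= /descent_poly coef_sum rmorph_sum /= mulr_suml.
  apply: eq_bigr => w _; rewrite coefXn eq_sym; congr (_ * _).
  by case: (_ == _).
rewrite exchange_big /=; apply: eq_bigr => w _.
set M := (\sum_i m i)%N.
have dM : (des (entries w) <= M)%N.
  by rewrite desE (leq_trans (des_from_size _ _)) // size_map size_tuple.
have [dk|kd] := leqP (des (entries w)) k; last first.
  (* A word with more than k descents contributes 0 to both sides. *)
  have bound d N : (d <= N -> k < d -> k + N - d < N)%N by lia.
  rewrite bin_small ?bound // big1 // => e _.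
  by rewrite gtn_eqF ?mul0r // (leq_trans (ltn_ord e)).
rewrite (bigD1 (Ordinal (dk : (des (entries w) < k.+1)%N))) //= eqxx mul1r.
rewrite [X in _ + X]big1 ?addr0 => [|e]; first by rewrite addnBAC.
by rewrite -val_eqE /= eq_sym => /negPf ->; rewrite mul0r.
Qed.

(** The descent polynomial and the numerator from [ex_gf_poly] have the same series, so they
    coincide. *)
Lemma root_descent_poly_lt1 (C : numClosedFieldType) n (m : 'I_n -> nat) (z : C) :
  root (map_poly intr (descent_poly m)) z -> z < 1.
Proof.
have [P [P1 _ gfP]] := ex_gf_poly C [seq m i | i <- enum 'I_n].
suff -> : map_poly intr (descent_poly m) = P by exact: P1.
apply: (@gf_coef_inj _ (\sum_i m i)) => k.
rewrite gf_coef_descent_poly; move: (gfP k).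
by rewrite sumnE 2!big_map !big_enum /= => ->.
Qed.

Local Open Scope complex_scope.

Theorem theorem4p2 (R : realType) (n : nat) (m : 'I_n -> nat)
    (hn : (1 <= n)%N) (hm : forall i : 'I_n, (0 < m i)%N) :
  forall z : R[i], root (map_poly intr (descent_poly m)) z -> complex.Im z = 0.
Proof.
(* In [R[i]] only numbers with equal imaginary parts are comparable, so z < 1 forces Im z = 0. *)
by move=> z /root_descent_poly_lt1; case: z => x y; rewrite ltcE => /andP[/eqP].
Qed.
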